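(* Let $R$ be an associative ring with $1$ and let $\Phi$ be a descending chain $\varphi_0\ge\varphi_1\ge\varphi_2\ge\dots$ of pp formulas of fixed arity over $R$. Let $B_\Phi$ be a Bass module for $\Phi$. If the chain $\Phi$ does not stabilize (uniformly in $R\text{-Mod}$), then the module $B_\Phi$ is not Mittag-Leffler, hence not pure-projective either.
   Context: All modules are unitary left $R$-modules; $R\text{-Mod}$ is the class of all of them. A module is pure-projective if it is a direct summand of a direct sum of finitely presented modules. A positive primitive (pp) formula in variables $\bar x$ is one of the form $\exists\bar y\,(A\bar y=B\bar x)$ with $A,B$ matrices over $R$ of matching sizes. For pp formulas of the same arity, $\varphi\le\psi$ means $\varphi(M)\subseteq\psi(M)$ for every $M\in R\text{-Mod}$. The pp type $\mathrm{pp}_M(\bar a)$ of a finite tuple $\bar a$ in $M$ is the set of all pp formulas satisfied by $\bar a$ in $M$. It is finitely generated if it contains a formula $\varphi$ with $\varphi\le\psi$ for every $\psi\in\mathrm{pp}_M(\bar a)$. A module is Mittag-Leffler if the pp type of every finite tuple in it is finitely generated. $(M,\bar a)$ is a free realization of a pp formula $\varphi$ if $\bar a$ satisfies $\varphi$ in $M$ and for every module $N$ and every tuple $\bar b$ satisfying $\varphi$ in $N$ there is a homomorphism $M\to N$ sending $\bar a$ to $\bar b$. A Bass module $B_\Phi$ for $\Phi$: choose finitely presented free realizations $(A_i,\bar a_i)$ of $\varphi_i$ and homomorphisms $g_i:A_i\to A_{i+1}$ with $g_i(\bar a_i)=\bar a_{i+1}$, for all $i<\omega$ (these exist because $\bar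 a_{i+1}$ satisfies $\varphi_i$ in $A_{i+1}$); $B_\Phi$ is the direct limit of the chain $A_0\to A_1\to A_2\to\dots$ along the $g_i$. The choice is not unique. The chain $\Phi$ stabilizes uniformly in $R\text{-Mod}$ if there is $n$ such that $\varphi_i(M)=\varphi_n(M)$ for all $i\ge n$ and all modules $M$. *)

(* Defs.v *)
From HB Require Import structures.
From mathcomp Require Import all_boot all_algebra.
From mathcomp Require Import boolp classical_sets functions cardinality.

Set Implicit Arguments.
Unset Strict Implicit.
Unset Printing Implicit Defensive.

Import GRing.Theory.
Local Open Scope classical_set_scope.
Local Open Scope ring_scope.

(* The rings are [pzRingType]s: associative, with 1, not necessarily
   commutative, and the zero ring is allowed. An [n]-tuple in a module [M] is a
   function ['I_n -> M]. *)

Section PositivePrimitive.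
Variable R : pzRingType.

(* The formula  exists y, A y = B x  in the free variables x_0, ..., x_(n-1). *)
Record pp_formula (n : nat) := PPFormula {
  pp_eqs : nat;
  pp_bound : nat;
  pp_lhs : 'M[R]_(pp_eqs, pp_bound);
  pp_rhs : 'M[R]_(pp_eqs, n)
}.

Definition pp_set n (phi : pp_formula n) (M : lmodType R) : set ('I_n -> M) :=
  [set x | exists y : 'I_(pp_bound phi) -> M, forall i : 'I_(pp_eqs phi),
     \sum_j pp_lhs phi i j *: y j = \sum_j pp_rhs phi i j *: x j].
Arguments pp_set [n] phi M.

Definition pp_le n (phi psi : pp_formula n) : Prop :=
  forall M : lmodType R, pp_set phi M `<=` pp_set psi M.

Definition pp_type (M : lmodType R) n (a : 'I_n -> M) : set (pp_formula n) :=
  [set phi | pp_set phi M a].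

Definition pp_type_fin_gen n (p : set (pp_formula n)) : Prop :=
  exists2 phi, p phi & forall psi, p psi -> pp_le phi psi.

Definition mittag_leffler (M : lmodType R) : Prop :=
  forall n (a : 'I_n -> M), pp_type_fin_gen (pp_type a).

Definition free_realization n (phi : pp_formula n) (M : lmodType R)
    (a : 'I_n -> M) : Prop :=
  pp_set phi M a /\
  forall (N : lmodType R) (b : 'I_n -> N), pp_set phi N b ->
    exists h : {linear M -> N}, forall j, h (a j) = b j.

Definition pp_descending n (Phi : nat -> pp_formula n) : Prop :=
  forall i, pp_le (Phi i.+1) (Phi i).

Definition pp_stabilizes n (Phi : nat -> pp_formula n) : Prop :=
  exists k, forall i, (k <= i)%N ->
    forall M : lmodType R, pp_set (Phi i) M = pp_set (Phi k) M.

End PositivePrimitive.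

(* External direct sum: the families of finite support, with the pointwise
   operations. *)
Section DirectSum.
Variables (R : pzRingType) (I : Type) (F : I -> lmodType R).

Record dsum := DSum {
  dsum_fun :> forall i, F i;
  dsum_fin : finite_set [set i | dsum_fun i != 0]
}.

HB.instance Definition _ := gen_eqMixin dsum.
HB.instance Definition _ := gen_choiceMixin dsum.

Lemma dsum_ext (x y : dsum) : (forall i, x i = y i) -> x = y.
Proof.
case: x y => [x fx] [y fy] /= exy.
have {}exy : x = y by apply: functional_extensionality_dep.
by case: y / exy fy => fy; rewrite (Prop_irrelevance fx fy).
Qed.

Fact dsum_zero_fin : finite_set [set i | (0 : F i) != 0].
Proof.
by apply: (sub_finite_set _ (@finite_set0 I)) => i /=; rewrite eqxx.
Qed.

Fact dsum_opp_fin (x : dsum) : finite_set [set i | - x i != 0].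
Proof.
by apply: (sub_finite_set _ (dsum_fin x)) => i /=; rewrite oppr_eq0.
Qed.

Fact dsum_add_fin (x y : dsum) : finite_set [set i | x i + y i != 0].
Proof.
have fxy : finite_set ([set i | x i != 0] `|` [set i | y i != 0]).
  by rewrite finite_setU; split; apply: dsum_fin.
apply: (sub_finite_set _ fxy) => i /=.
have [-> | nx _] := eqVneq (x i) 0; last by left.
by rewrite add0r; right.
Qed.

Fact dsum_scale_fin (c : R) (x : dsum) : finite_set [set i | c *: x i != 0].
Proof.
apply: (sub_finite_set _ (dsum_fin x)) => i /=.
by apply: contra_neq => ->; rewrite scaler0.
Qed.

Definition dsum_zero := DSum dsum_zero_fin.
Definition dsum_opp x := DSum (dsum_opp_fin x).
Definition dsum_add x y := DSum (dsum_add_fin x y).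
Definition dsum_scale c x := DSum (dsum_scale_fin c x).

Fact dsum_addA : associative dsum_add.
Proof. by move=> x y z; apply: dsum_ext => i /=; rewrite addrA. Qed.

Fact dsum_addC : commutative dsum_add.
Proof. by move=> x y; apply: dsum_ext => i /=; rewrite addrC. Qed.

Fact dsum_add0 : left_id dsum_zero dsum_add.
Proof. by move=> x; apply: dsum_ext => i /=; rewrite add0r. Qed.

Fact dsum_addN : left_inverse dsum_zero dsum_opp dsum_add.
Proof. by move=> x; apply: dsum_ext => i /=; rewrite addNr. Qed.

HB.instance Definition _ :=
  GRing.isZmodule.Build dsum dsum_addA dsum_addC dsum_add0 dsum_addN.

Fact dsum_scaleA a b x : dsum_scale a (dsum_scale b x) = dsum_scale (a * b) x.
Proof. by apply: dsum_ext => i /=; rewrite scalerA. Qed.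

Fact dsum_scale1 : left_id 1 dsum_scale.
Proof. by move=> x; apply: dsum_ext => i /=; rewrite scale1r. Qed.

Fact dsum_scaleDr : right_distributive dsum_scale +%R.
Proof. by move=> a x y; apply: dsum_ext => i /=; rewrite scalerDr. Qed.

Fact dsum_scaleDl x : {morph dsum_scale^~ x : a b / a + b}.
Proof. by move=> a b; apply: dsum_ext => i /=; rewrite scalerDl. Qed.

HB.instance Definition _ := GRing.Zmodule_isLmodule.Build R dsum
  dsum_scaleA dsum_scale1 dsum_scaleDr dsum_scaleDl.

End DirectSum.

Section Modules.
Variable R : pzRingType.

(* Exactness of  R^m -> R^n -> M -> 0. *)
Definition fin_presented (M : lmodType R) : Prop :=
  exists (m n : nat) (r : {linear 'rV[R]_m -> 'rV[R]_n})
    (q : {linear 'rV[R]_n -> M}),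
    (forall x : M, exists v, q v = x) /\
    (forall v, q v = 0 <-> exists w, r w = v).

Definition direct_summand (M P : lmodType R) : Prop :=
  exists (N : lmodType R) (h : {linear (M * N)%type -> P}), bijective h.

Definition pure_projective (M : lmodType R) : Prop :=
  exists (I : Type) (F : I -> lmodType R),
    (forall i, fin_presented (F i)) /\ direct_summand M (dsum F).

Definition is_cocone (A : nat -> lmodType R)
    (g : forall i, {linear A i -> A i.+1})
    (C : lmodType R) (h : forall i, {linear A i -> C}) : Prop :=
  forall i x, h i.+1 (g i x) = h i x.

(* [B] with the maps [f i] is the direct limit of  A 0 -> A 1 -> A 2 -> ... ;
   it is determined by its universal property up to isomorphism. *)
Definition is_direct_limit (A : nat -> lmodType R)
    (g : forall i, {linear A i -> A i.+1})
    (B : lmodType R) (f : forall i, {linear A i -> B}) : Prop :=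
  is_cocone g f /\
  forall (C : lmodType R) (h : forall i, {linear A i -> C}), is_cocone g h ->
    exists u : {linear B -> C}, (forall i x, u (f i x) = h i x) /\
      forall u' : {linear B -> C}, (forall i x, u' (f i x) = h i x) -> u' =1 u.

Definition is_bass_module n (Phi : nat -> pp_formula R n) (B : lmodType R) :
    Prop :=
  exists (A : nat -> lmodType R) (a : forall i, 'I_n -> A i)
    (g : forall i, {linear A i -> A i.+1}) (f : forall i, {linear A i -> B}),
    [/\ forall i, fin_presented (A i),
        forall i, free_realization (Phi i) (a i),
        forall i j, g i (a i j) = a i.+1 j
      & is_direct_limit g f].

End Modules.

(* Main.v *)
Require Import Defs.
From HB Require Import structures.
From mathcomp Require Import all_boot all_algebra.
From mathcomp Require Import boolp classical_sets functions cardinality.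

Set Implicit Arguments.
Unset Strict Implicit.
Unset Printing Implicit Defensive.

Import GRing.Theory.
Local Open Scope ring_scope.

(** A free realization is a universal solution: if [a] freely realizes [phi]
    and satisfies [psi], then so does every tuple satisfying [phi], because it
    is a homomorphic image of [a] ([free_realization_generates]).

    Let [A_0 -> A_1 -> ...] be a chain with limit [B] whose stages carry free
    realizations [a_k] of [Phi k], each mapped to the next.  All the [a_k] have
    the same image [b] in [B], so [b] satisfies every [Phi i].  Conversely, a pp
    formula true of [b] is already true of [a_k] in [A_k] for some [k], since it
    amounts to finitely many equations ([direct_limit_pp]).  If the pp type of
    [b] were generated by one formula [phi], then [phi] would hold at some
    [a_k], whence [Phi k <= phi <= Phi i] for all [i], and the chain would be
    constant from [k] on.

    The limit is known only through its universal property.  Instead of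
    comparing it with an explicit colimit, [direct_limit_pp] maps [B] to the
    product of the [A_k] modulo eventual equality.  There [b] becomes the class
    of the sequence [k |-> a_k]; as finitely many eventual equalities hold
    simultaneously at some stage, pp formulas descend from this quotient to a
    single [A_k].

    That pure-projective modules are Mittag-Leffler
    ([pure_projective_mittag_leffler]) is shown in three steps.  A tuple in a
    finitely presented module freely realizes the formula that lists the
    relations of the module and writes the tuple in terms of the generators
    ([fin_presented_free_realization]).  A tuple in a direct sum has finite
    support, so it is a finite sum of tuples lying in single summands, and the
    sum of the generators of their pp types generates its pp type
    ([mittag_leffler_dsum]).  Finally, a direct summand computes the same pp
    types as the ambient module ([mittag_leffler_summand]). *)

(** * Positive primitive formulas *)

Section Formulas.
Variable R : pzRingType.

Lemma pp_set_linear n (phi : pp_formula R n) (M N : lmodType R)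
    (h : {linear M -> N}) (a : 'I_n -> M) :
  pp_set phi a -> pp_set phi (h \o a).
Proof.
move=> [y Hy]; exists (h \o y) => i.
have := congr1 h (Hy i); rewrite !linear_sum /=.
by under eq_bigr do rewrite linearZ; under [RHS]eq_bigr do rewrite linearZ.
Qed.

Lemma pp_setD n (phi : pp_formula R n) (M : lmodType R) (a b : 'I_n -> M) :
  pp_set phi a -> pp_set phi b -> pp_set phi (fun j => a j + b j).
Proof.
move=> [y Hy] [z Hz]; exists (fun j => y j + z j) => i.
under eq_bigr do rewrite scalerDr; under [RHS]eq_bigr do rewrite scalerDr.
by rewrite !big_split /= Hy Hz.
Qed.

Lemma pp_set0 n (phi : pp_formula R n) (M : lmodType R) (a : 'I_n -> M) :
  (forall j, a j = 0) -> pp_set phi a.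
Proof.
move=> a0; exists (fun=> 0) => i.
by rewrite !big1 // => j _; rewrite ?a0 scaler0.
Qed.

Lemma sum_scalar1 n (M : lmodType R) (x : 'I_n -> M) (i : 'I_n) :
  \sum_j (1%:M : 'M[R]_n) i j *: x j = x i.
Proof.
rewrite (bigD1 i) //= mxE eqxx scale1r big1 ?addr0 // => j /negPf ji.
by rewrite mxE eq_sym ji scale0r.
Qed.

Lemma sum_scale0 m n (M : lmodType R) (x : 'I_n -> M) (i : 'I_m) :
  \sum_j (0 : 'M[R]_(m, n)) i j *: x j = 0.
Proof. by rewrite big1 // => j _; rewrite mxE scale0r. Qed.

Lemma sum_col_mxu m1 m2 n (M : lmodType R) (A : 'M[R]_(m1, n))
    (C : 'M[R]_(m2, n)) (x : 'I_n -> M) (i : 'I_m1) :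
  \sum_j col_mx A C (lshift m2 i) j *: x j = \sum_j A i j *: x j.
Proof. by apply: eq_bigr => j _; rewrite col_mxEu. Qed.

Lemma sum_col_mxd m1 m2 n (M : lmodType R) (A : 'M[R]_(m1, n))
    (C : 'M[R]_(m2, n)) (x : 'I_n -> M) (i : 'I_m2) :
  \sum_j col_mx A C (rshift m1 i) j *: x j = \sum_j C i j *: x j.
Proof. by apply: eq_bigr => j _; rewrite col_mxEd. Qed.

Definition pp_zero n : pp_formula R n :=
  @PPFormula R n n 0 0 1%:M.

Lemma pp_zeroP n (M : lmodType R) (x : 'I_n -> M) :
  pp_set (pp_zero n) x <-> forall j, x j = 0.
Proof.
split=> [[y Hy] j|]; last exact: pp_set0.
by have := Hy j; rewrite /= big_ord0 sum_scalar1 => <-.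
Qed.

(** The pp formula [exists a, phi a /\ psi (x - a)]: the last [n] bound
    variables are the tuple [a]; moving it to the left-hand sides gives
    [- pp_rhs phi] in the equations of [phi a], and [+ pp_rhs psi] in those of
    [psi (x - a)]. *)
Definition pp_sum n (phi psi : pp_formula R n) : pp_formula R n :=
  PPFormula
    (row_mx (block_mx (pp_lhs phi) 0 0 (pp_lhs psi))
            (col_mx (- pp_rhs phi) (pp_rhs psi)))
    (col_mx 0 (pp_rhs psi)).

Lemma pp_sumP n (phi psi : pp_formula R n) (M : lmodType R) (x : 'I_n -> M) :
  pp_set (pp_sum phi psi) x <->
  exists a b : 'I_n -> M,
    [/\ pp_set phi a, pp_set psi b & forall j, x j = a j + b j].
Proof.
split=> [[y Hy]|[a [b [[y Hy] [z Hz] xE]]]].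
- pose a j := y (rshift _ j).
  exists a, (fun j => x j - a j); split; last by move=> j; rewrite addrC subrK.
  + exists (fun j => y (lshift _ (lshift _ j))) => i.
    have := Hy (lshift _ i); rewrite /= !big_split_ord /=.
    under eq_bigr do rewrite row_mxEl block_mxEul.
    under [X in _ + X + _]eq_bigr do rewrite row_mxEl block_mxEur.
    under [X in _ + X]eq_bigr do rewrite row_mxEr col_mxEu mxE scaleNr.
    under [RHS]eq_bigr do rewrite col_mxEu.
    rewrite !sum_scale0 addr0 sumrN => /eqP; rewrite subr_eq0 => /eqP; exact.
  + exists (fun j => y (lshift _ (rshift _ j))) => i.
    have := Hy (rshift _ i); rewrite /= !big_split_ord /=.
    under eq_bigr do rewrite row_mxEl block_mxEdl.
    under [X in _ + X + _]eq_bigr do rewrite row_mxEl block_mxEdr.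
    under [X in _ + X]eq_bigr do rewrite row_mxEr col_mxEd.
    under [RHS]eq_bigr do rewrite col_mxEd.
    rewrite !sum_scale0 add0r => /eqP; rewrite eq_sym -subr_eq => /eqP <-.
    by under [RHS]eq_bigr do rewrite scalerBr; rewrite sumrB.
- pose w (j : 'I_(pp_bound phi + pp_bound psi + n)) : M :=
    match fintype.split j with
    | inl k => match fintype.split k with inl l => y l | inr l => z l end
    | inr k => a k
    end.
  have wa j : w (rshift _ j) = a j by rewrite /w (unsplitK (inr _ j)).
  have wy j : w (lshift _ (lshift _ j)) = y j.
    by rewrite /w (unsplitK (inl _ _)) (unsplitK (inl _ j)).
  have wz j : w (lshift _ (rshift _ j)) = z j.
    by rewrite /w (unsplitK (inl _ _)) (unsplitK (inr _ j)).
  exists w => i; rewrite /= !big_split_ord /=.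
  under eq_bigr do rewrite wy row_mxEl.
  under [X in _ + X + _]eq_bigr do rewrite wz row_mxEl.
  under [X in _ + X]eq_bigr do rewrite wa row_mxEr.
  case: (split_ordP i) => k ->.
  + under eq_bigr do rewrite block_mxEul.
    under [X in _ + X + _]eq_bigr do rewrite block_mxEur.
    under [X in _ + X]eq_bigr do rewrite col_mxEu mxE scaleNr.
    under [RHS]eq_bigr do rewrite col_mxEu.
    by rewrite !sum_scale0 addr0 sumrN Hy subrr.
  + under eq_bigr do rewrite block_mxEdl.
    under [X in _ + X + _]eq_bigr do rewrite block_mxEdr.
    under [X in _ + X]eq_bigr do rewrite col_mxEd.
    under [RHS]eq_bigr do rewrite col_mxEd xE scalerDr.
    by rewrite sum_scale0 add0r Hz big_split /= addrC.
Qed.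

Lemma free_realization_generates n (phi : pp_formula R n) (M : lmodType R)
    (a : 'I_n -> M) (psi : pp_formula R n) :
  free_realization phi a -> pp_set psi a -> pp_le phi psi.
Proof.
move=> [_ free] psia N b /free[h hab].
by rewrite (_ : b = h \o a); [exact: pp_set_linear | apply/funext => j /=].
Qed.

End Formulas.

(** * Finitely presented modules *)

Section FinitelyPresented.
Variable R : pzRingType.

Section LinearCombination.
Variables (n : nat) (M : lmodType R) (y : 'I_n -> M).

Definition lincomb (v : 'rV[R]_n) : M := \sum_j v 0 j *: y j.

Fact lincomb_is_linear : linear lincomb.
Proof.
move=> c u v; rewrite /lincomb scaler_sumr -big_split /=.
by apply: eq_bigr => j _; rewrite !mxE scalerDl scalerA.
Qed.

HB.instance Definition _ :=
  GRing.isLinear.Build R 'rV[R]_n M *:%R lincomb lincomb_is_linear.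
End LinearCombination.

Lemma linear_lincomb n (M N : lmodType R) (h : {linear M -> N})
    (y : 'I_n -> M) (v : 'rV[R]_n) :
  h (lincomb y v) = lincomb (h \o y) v.
Proof. by rewrite linear_sum; apply: eq_bigr => j _; rewrite linearZ. Qed.

Lemma lincomb_delta n (v : 'rV[R]_n) : v = lincomb (delta_mx 0) v.
Proof. exact: row_sum_delta. Qed.

Lemma linear_rV n (N : lmodType R) (h : {linear 'rV[R]_n -> N}) v :
  h v = lincomb (h \o delta_mx 0) v.
Proof. by rewrite -linear_lincomb -lincomb_delta. Qed.

Lemma linear_factor (L M N : lmodType R) (q : {linear L -> M})
    (k : {linear L -> N}) :
  (forall x, exists v, q v = x) -> (forall v, q v = 0 -> k v = 0) ->
  exists h : {linear M -> N}, forall v, h (q v) = k v.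
Proof.
move=> qsurj kerqk; have [s sK] := choice qsurj.
have kE u v : q u = q v -> k u = k v.
  move=> quv; apply/eqP; rewrite -subr_eq0 -linearB; apply/eqP/kerqk.
  by rewrite linearB quv subrr.
have lin : linear (k \o s).
  by move=> c x y /=; rewrite -linearP; apply: kE; rewrite linearP !sK.
pose h : {linear M -> N} := HB.pack (k \o s)
  (GRing.isLinear.Build R M N *:%R _ lin).
by exists h => v; apply: kE; rewrite sK.
Qed.

(** With generators [e_j] and relations [r e_k] of [M], and a lift [v k] of each
    [a k] along the presentation, the formula is
    [exists y, r(y) = 0 /\ v(y) = x].  A solution [y] in [N] is exactly a choice
    of images of the generators that respects the relations, hence a
    homomorphism from [M] to [N], and it maps [a] to [x]. *)
Lemma fin_presented_free_realization (M : lmodType R) l (a : 'I_l -> M) :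
  fin_presented M -> exists phi, free_realization phi a.
Proof.
move=> [m [n [r [q [qsurj kerq]]]]].
have [v vE] := choice (fun i => qsurj (a i)).
pose rel : 'M[R]_(m, n) := \matrix_(k, j) r (delta_mx 0 k) 0 j.
pose gen : 'M[R]_(l, n) := \matrix_(k, j) v k 0 j.
pose phi := PPFormula (col_mx rel gen) (col_mx 0 1%:M).
have phiP (N : lmodType R) (b : 'I_l -> N) : pp_set phi b <->
    exists y : 'I_n -> N, (forall k, lincomb y (r (delta_mx 0 k)) = 0) /\
      forall k, lincomb y (v k) = b k.
  split=> [[y Hy]|[y [ry vy]]]; exists y.
    split=> k.
      have := Hy (lshift _ k); rewrite /= !sum_col_mxu.
      by rewrite sum_scale0 => <-; apply: eq_bigr => j _; rewrite mxE.
    have := Hy (rshift _ k); rewrite /= !sum_col_mxd.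
    by rewrite sum_scalar1 => <-; apply: eq_bigr => j _; rewrite mxE.
  move=> i; case: (split_ordP i) => k ->.
    rewrite /= !sum_col_mxu.
    by rewrite sum_scale0; apply: etrans (ry k);
      apply: eq_bigr => j _; rewrite mxE.
  rewrite /= !sum_col_mxd.
  by rewrite sum_scalar1; apply: etrans (vy k);
    apply: eq_bigr => j _; rewrite mxE.
exists phi; split.
  apply/phiP; exists (q \o delta_mx 0); split=> k; rewrite -linear_rV //.
  by apply/kerq; exists (delta_mx 0 k).
move=> N b /phiP[y [ry vy]].
have [|h hE] := linear_factor (k := lincomb y) qsurj.
  move=> u /kerq[w <-]; rewrite (linear_rV r) linear_lincomb.
  by rewrite /lincomb big1 // => k _; rewrite /= ry scaler0.
by exists h => j; rewrite -vE hE; apply: vy.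
Qed.

Lemma fin_presented_mittag_leffler (M : lmodType R) :
  fin_presented M -> mittag_leffler M.
Proof.
move=> fpM n a; have [phi frphi] := fin_presented_free_realization a fpM.
exists phi; first by case: frphi.
by move=> psi; apply: free_realization_generates.
Qed.

End FinitelyPresented.

(** * Direct summands and direct sums *)

Section DirectSums.
Variable R : pzRingType.

Lemma pp_set_retract n (psi : pp_formula R n) (M N : lmodType R)
    (h : {linear M -> N}) (k : {linear N -> M}) (a : 'I_n -> M) :
  cancel h k -> pp_set psi (h \o a) <-> pp_set psi a.
Proof.
move=> hK; split; last exact: pp_set_linear.
move=> /(pp_set_linear k); congr (pp_set psi _).
by apply/funext => j /=; rewrite hK.
Qed.

Lemma mittag_leffler_summand (M P : lmodType R) :
  direct_summand M P -> mittag_leffler P -> mittag_leffler M.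
Proof.
move=> [N [h [h' hK h'K]]] mlP n a.
pose k : {linear P -> (M * N)%type} :=
  HB.pack h' (GRing.isLinear.Build R P (M * N)%type *:%R h'
    (can2_linear hK h'K)).
have inl_linear : linear (fun x : M => (x, 0 : N)).
  by move=> c x y; congr pair; rewrite /= scaler0 addr0.
pose incl : {linear M -> (M * N)%type} := HB.pack (fun x : M => (x, 0 : N))
  (GRing.isLinear.Build R M (M * N)%type *:%R _ inl_linear).
have [phi phia gen] := mlP n (h \o incl \o a).
have retr psi : pp_set psi (h \o incl \o a) <-> pp_set psi a.
  apply: (@pp_set_retract _ _ _ _ (h \o incl) (fst \o k)) => x /=.
  by rewrite /k /= hK.
by exists phi => [|psi /retr]; [exact/retr | exact: gen].
Qed.

(** The generators of the pp types of [a] and [b] both imply every formula true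
    of [c], hence so does their sum, solution sets being closed under addition.
    The typical [a] and [b] are images of [c] under endomorphisms. *)
Lemma pp_type_fin_gen_sum n (M : lmodType R) (a b c : 'I_n -> M) :
  (forall j, c j = a j + b j) ->
  (forall psi : pp_formula R n, pp_set psi c -> pp_set psi a /\ pp_set psi b) ->
  pp_type_fin_gen (pp_type a) -> pp_type_fin_gen (pp_type b) ->
  pp_type_fin_gen (pp_type c).
Proof.
move=> cE split_c [phi phia genphi] [chi chib genchi].
exists (pp_sum phi chi); first by apply/pp_sumP; exists a, b.
move=> psi /split_c[psia psib] N x /pp_sumP[y [z [phiy chiz xE]]].
rewrite (_ : x = fun j => y j + z j); last exact/funext.
by apply: pp_setD; [exact: genphi phiy | exact: genchi chiz].
Qed.

Section FiniteSupport.
Variables (I : choiceType) (F : I -> lmodType R).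

Definition dsum_proj i (x : dsum F) : F i := x i.

Fact dsum_proj_linear i : linear (@dsum_proj i). Proof. by []. Qed.

HB.instance Definition _ i :=
  GRing.isLinear.Build R (dsum F) (F i) *:%R (@dsum_proj i)
    (dsum_proj_linear i).

Definition single i (x : F i) k : F k :=
  if i =P k is ReflectT e then ecast l (F l) e x else 0.

Lemma single_id i (x : F i) : single x i = x.
Proof. by rewrite /single; case: eqP => // e; rewrite eq_axiomK. Qed.

Lemma single_neq i (x : F i) k : k != i -> single x k = 0.
Proof. by rewrite /single; case: eqP => // e /eqP[]. Qed.

Fact single_fin i (x : F i) : finite_set [set k | single x k != 0]%classic.
Proof.
apply: (sub_finite_set _ (finite_set1 i)) => k /=.
by apply: contra_neqP => /eqP; apply: single_neq.
Qed.

Definition dsum_inj i (x : F i) : dsum F := DSum (single_fin x).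

Fact dsum_inj_linear i : linear (@dsum_inj i).
Proof.
move=> c x y; apply: dsum_ext => k /=.
have [-> | ki] := eqVneq k i; first by rewrite !single_id.
by rewrite !single_neq // scaler0 addr0.
Qed.

HB.instance Definition _ i :=
  GRing.isLinear.Build R (F i) (dsum F) *:%R (@dsum_inj i)
    (@dsum_inj_linear i).

Lemma dsum_injK i : cancel (@dsum_inj i) (@dsum_proj i).
Proof. exact: single_id. Qed.

(** Induction on the support: the projection [e] onto one coordinate and its
    complement [e'] split [c] into the tuple [e \o c], whose pp type is computed
    in one summand, and a tuple of smaller support. *)
Lemma dsum_support_fin_gen n (s : seq I) (c : 'I_n -> dsum F) :
  (forall i, mittag_leffler (F i)) ->
  (forall i j, i \notin s -> c j i = 0) -> pp_type_fin_gen (pp_type c).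
Proof.
move=> mlF; elim: s c => [|i s IHs] c supp.
  have c0 j : c j = 0 by apply: dsum_ext => i; apply: supp.
  exists (pp_zero R n); first exact/pp_zeroP.
  by move=> psi _ N x /pp_zeroP; apply: pp_set0.
pose e : {linear dsum F -> dsum F} := @dsum_inj i \o @dsum_proj i.
pose e' : {linear dsum F -> dsum F} := idfun \- e.
apply: (@pp_type_fin_gen_sum _ _ (e \o c) (e' \o c)).
- by move=> j /=; rewrite addrC subrK.
- by move=> psi psic; split; apply: pp_set_linear.
- have [phi phii gen] := mlF i n (@dsum_proj i \o c).
  have retr psi : pp_set psi (e \o c) <-> pp_set psi (@dsum_proj i \o c).
    exact: (@pp_set_retract _ psi _ _ (@dsum_inj i) (@dsum_proj i)
      (@dsum_proj i \o c) (@dsum_injK i)).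
  by exists phi => [|psi /retr]; [exact/retr | exact: gen].
- apply: IHs => k j ks /=; have [-> | ki] := eqVneq k i.
    by rewrite single_id subrr.
  by rewrite single_neq // oppr0 addr0 supp // inE negb_or ki.
Qed.

Lemma mittag_leffler_dsum_choice :
  (forall i, mittag_leffler (F i)) -> mittag_leffler (dsum F).
Proof.
move=> mlF n c.
have : finite_set (\bigcup_(j in setT) [set i | c j i != 0])%classic.
  by apply: bigcup_finite => // j _; apply: dsum_fin.
case/finite_seqP => s sE; apply: (@dsum_support_fin_gen _ s) => // i j.
apply: contraNeq => cji; suff : [set` s]%classic i by [].
by rewrite -sE; exists j.
Qed.

End FiniteSupport.

Lemma mittag_leffler_dsum (I : Type) (F : I -> lmodType R) :
  (forall i, mittag_leffler (F i)) -> mittag_leffler (dsum F).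
Proof. exact: (@mittag_leffler_dsum_choice {classic I}). Qed.

Lemma pure_projective_mittag_leffler (M : lmodType R) :
  pure_projective M -> mittag_leffler M.
Proof.
move=> [I [F [fpF sumF]]]; apply: mittag_leffler_summand sumF _.
by apply: mittag_leffler_dsum => i; apply: fin_presented_mittag_leffler.
Qed.

End DirectSums.

(** * Sequences modulo eventual equality *)

Section Germs.
Variables (R : pzRingType) (A : nat -> lmodType R).

(** The product of the [A k], as a type of its own so that it can carry the
    choice structure that quotients require. *)
Definition threads := forall k, A k.

HB.instance Definition _ := gen_eqMixin threads.
HB.instance Definition _ := gen_choiceMixin threads.

Definition ev_eq (x y : threads) : bool :=
  `[< exists m, forall k, (m <= k)%N -> x k = y k >].

Fact ev_eq_equiv : equiv_class_of ev_eq.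
Proof.
split=> [x|x y|y x z].
- by apply/asboolP; exists 0%N.
- by apply/asbool_equiv_eq; split=> -[m xy]; exists m => k /xy.
- move=> /asboolP[m xy] /asboolP[p yz]; apply/asboolP; exists (maxn m p) => k.
  by rewrite geq_max => /andP[/xy -> /yz].
Qed.

Canonical ev_eq_equivRel := EquivRelPack ev_eq_equiv.
Canonical ev_eq_encModRel := defaultEncModRel ev_eq.

Definition germ := {eq_quot ev_eq}%qT.

HB.instance Definition _ : EqQuotient threads ev_eq germ := EqQuotient.on germ.
HB.instance Definition _ := Choice.on germ.

Definition germ_of (x : threads) : germ := (\pi_germ x)%qT.

Lemma germ_eqP x y :
  germ_of x = germ_of y <-> exists m, forall k, (m <= k)%N -> x k = y k.
Proof.
split=> [/eqP|xy]; first by rewrite /germ_of piE => /asboolP.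
by apply/eqP; rewrite /germ_of piE; apply/asboolP.
Qed.

Lemma germ_ext (x y : threads) : (forall k, x k = y k) ->
  germ_of x = germ_of y.
Proof. by move=> xy; apply/germ_eqP; exists 0%N. Qed.

Lemma germ_surj (u : germ) : exists x, u = germ_of x.
Proof. by exists (repr u); rewrite /germ_of reprK. Qed.

Definition germ_zero : germ := germ_of (fun=> 0).
Definition germ_opp (u : germ) : germ := germ_of (fun k => - repr u k).
Definition germ_add (u v : germ) : germ :=
  germ_of (fun k => repr u k + repr v k).
Definition germ_scale (c : R) (u : germ) : germ :=
  germ_of (fun k => c *: repr u k).

Lemma germ_reprP x :
  exists m, forall k, (m <= k)%N -> repr (germ_of x) k = x k.
Proof. by apply/germ_eqP; rewrite /germ_of reprK. Qed.

Lemma germ_oppE x : germ_opp (germ_of x) = germ_of (fun k => - x k).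
Proof.
by have [m mP] := germ_reprP x; apply/germ_eqP; exists m => k /mP ->.
Qed.

Lemma germ_addE x y :
  germ_add (germ_of x) (germ_of y) = germ_of (fun k => x k + y k).
Proof.
have [m mP] := germ_reprP x; have [p pP] := germ_reprP y.
apply/germ_eqP; exists (maxn m p) => k.
by rewrite geq_max => /andP[/mP -> /pP ->].
Qed.

Lemma germ_scaleE c x : germ_scale c (germ_of x) = germ_of (fun k => c *: x k).
Proof.
by have [m mP] := germ_reprP x; apply/germ_eqP; exists m => k /mP ->.
Qed.

Definition germE := (germ_oppE, germ_addE, germ_scaleE).

Fact germ_addA : associative germ_add.
Proof.
move=> u v w; have [x ->] := germ_surj u; have [y ->] := germ_surj v.
by have [z ->] := germ_surj w; rewrite !germE;
  apply: germ_ext => k; apply: addrA.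
Qed.

Fact germ_addC : commutative germ_add.
Proof.
move=> u v; have [x ->] := germ_surj u; have [y ->] := germ_surj v.
by rewrite !germE;
  apply: germ_ext => k; apply: addrC.
Qed.

Fact germ_add0 : left_id germ_zero germ_add.
Proof.
by move=> u; have [x ->] := germ_surj u; rewrite !germE;
  apply: germ_ext => k; apply: add0r.
Qed.

Fact germ_addN : left_inverse germ_zero germ_opp germ_add.
Proof.
by move=> u; have [x ->] := germ_surj u; rewrite !germE;
  apply: germ_ext => k; apply: addNr.
Qed.

HB.instance Definition _ :=
  GRing.isZmodule.Build germ germ_addA germ_addC germ_add0 germ_addN.

Fact germ_scaleA a b u : germ_scale a (germ_scale b u) = germ_scale (a * b) u.
Proof.
by have [x ->] := germ_surj u; rewrite !germE;
  apply: germ_ext => k; apply: scalerA.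
Qed.

Fact germ_scale1 : left_id 1 germ_scale.
Proof.
by move=> u; have [x ->] := germ_surj u; rewrite !germE;
  apply: germ_ext => k; apply: scale1r.
Qed.

Fact germ_scaleDr : right_distributive germ_scale +%R.
Proof.
move=> a u v; have [x ->] := germ_surj u; have [y ->] := germ_surj v.
rewrite [in RHS]/+%R [in LHS]/+%R /= !germE.
by apply: germ_ext => k; apply: scalerDr.
Qed.

Fact germ_scaleDl u : {morph germ_scale^~ u : a b / a + b}.
Proof.
move=> a b; have [x ->] := germ_surj u.
rewrite [in RHS]/+%R /= !germE.
by apply: germ_ext => k; apply: scalerDl.
Qed.

HB.instance Definition _ := GRing.Zmodule_isLmodule.Build R germ
  germ_scaleA germ_scale1 germ_scaleDr germ_scaleDl.

Lemma germ_sum (I : Type) (r : seq I) (c : I -> R) (x : I -> threads) :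
  \sum_(i <- r) c i *: germ_of (x i) =
  germ_of (fun k => \sum_(i <- r) c i *: x i k).
Proof.
elim: r => [|i r IHr].
  by rewrite big_nil; apply: germ_ext => k; rewrite big_nil.
rewrite big_cons IHr [X in X + _]germ_scaleE [LHS]germ_addE.
by apply: germ_ext => k; rewrite big_cons.
Qed.

(** The witnesses lift to sequences, and each of the finitely many equations
    holds from some index on; the largest of these indices serves for all. *)
Lemma pp_set_germ n (phi : pp_formula R n) (x : 'I_n -> threads) :
  pp_set phi (fun j => germ_of (x j)) ->
  exists k, pp_set phi (fun j => x j k).
Proof.
move=> [u Hu]; have [y yE] := choice (fun j => germ_surj (u j)).
have ev i : exists m, forall k, (m <= k)%N ->
    \sum_j pp_lhs phi i j *: y j k = \sum_j pp_rhs phi i j *: x j k.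
  apply/germ_eqP; rewrite -!germ_sum -Hu.
  by apply: eq_bigr => j _; rewrite yE.
have [m mP] := choice ev.
exists (\max_i m i), (fun j => y j (\max_i m i)) => i.
by apply: mP; apply: leq_bigmax.
Qed.

End Germs.

(** * Direct limits of chains *)

Section Chain.
Variable R : pzRingType.

(** The composite [A i -> A k] of the chain for [i <= k], and zero for [k < i].
    Recursion on [i] shifts the chain, so that both the diagonal [i = k] and the
    step [k.+1] are reached without transporting along equalities of indices. *)
Fixpoint transition (A : nat -> lmodType R)
    (g : forall i, {linear A i -> A i.+1})
    (i : nat) {struct i} : forall k, {linear A i -> A k} :=
  match i return forall k, {linear A i -> A k} with
  | 0 => fix aux k : {linear A 0 -> A k} :=
      match k return {linear A 0 -> A k} with
      | 0 => idfun
      | k'.+1 => g k' \o aux k'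
      end
  | i'.+1 => fun k => match k return {linear A i'.+1 -> A k} with
      | 0 => \0
      | k'.+1 => transition (A := fun j => A j.+1) (fun j => g j.+1) i' k'
      end
  end.

Lemma transition_id A g i x : transition (A := A) g i i x = x.
Proof. by elim: i A g x => [|i IHi] A g x //=; apply: IHi. Qed.

Lemma transition_next A g i k x :
  (i <= k)%N -> transition (A := A) g i k.+1 x = g k (transition g i k x).
Proof.
elim: i k A g x => [|i IHi] [|k] A g x //= ik.
exact: (IHi k (fun j => A j.+1) (fun j => g j.+1)).
Qed.

Variables (A : nat -> lmodType R) (g : forall i, {linear A i -> A i.+1}).

Lemma transition_prev i k x :
  (i < k)%N -> transition g i.+1 k (g i x) = transition g i k x.
Proof.
elim: k => // k IHk; rewrite ltnS leq_eqVlt => /predU1P[ik|ik].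
  by case: _ / ik; rewrite transition_id transition_next // transition_id.
by rewrite !transition_next ?IHk // ltnW.
Qed.

Lemma transition_coherent n (a : forall i, 'I_n -> A i) :
  (forall i j, g i (a i j) = a i.+1 j) ->
  forall i j k, (i <= k)%N -> transition g i k (a i j) = a k j.
Proof.
move=> ga i j k; elim: k => [|k IHk]; last first.
  rewrite leq_eqVlt ltnS => /predU1P[->|ik]; first exact: transition_id.
  by rewrite transition_next // IHk.
by rewrite leqn0 => /eqP ->; apply: transition_id.
Qed.

(** Zero below the index [i], which does not affect the class; these maps form
    a cocone because [transition] does not depend on the stage at which an
    element is taken, as soon as [k] is large. *)
Definition to_germ i (x : A i) : germ A :=
  germ_of (fun k => transition g i k x).

Fact to_germ_linear i : linear (@to_germ i).
Proof.
move=> c x y; transitivity (germ_add (germ_scale c (to_germ x)) (to_germ y));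
  last by [].
rewrite /to_germ !germE; apply: germ_ext => k; exact: linearP.
Qed.

HB.instance Definition _ i :=
  GRing.isLinear.Build R (A i) (germ A) *:%R (@to_germ i) (@to_germ_linear i).

Lemma to_germ_cocone : is_cocone g (fun i => @to_germ i).
Proof.
by move=> i x; apply/germ_eqP; exists i.+1 => k; apply: transition_prev.
Qed.

(** The universal property turns the maps [to_germ] into a homomorphism from
    [B], which sends the common image of the [a k] to the class of [k |-> a k];
    homomorphisms preserve pp formulas, and [pp_set_germ] finds the stage. *)
Lemma direct_limit_pp n (phi : pp_formula R n) (B : lmodType R)
    (f : forall i, {linear A i -> B}) (a : forall i, 'I_n -> A i) :
  is_direct_limit g f -> (forall i j, g i (a i j) = a i.+1 j) ->
  pp_set phi (f 0%N \o a 0%N) -> exists k, pp_set phi (a k).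
Proof.
move=> [_ univ] ga phib; have [u [uE _]] := univ _ _ to_germ_cocone.
apply: (@pp_set_germ _ _ _ _ (fun j k => a k j)).
have := pp_set_linear u phib; congr (pp_set _ _).
apply/funext => j /=; rewrite uE; apply: germ_ext => k.
exact: transition_coherent.
Qed.

End Chain.

(** * The Bass module of a chain that does not stabilize *)

Theorem lemma5 (R : pzRingType) (n : nat) (Phi : nat -> pp_formula R n)
    (B : lmodType R) (hPhi : pp_descending Phi) (hB : is_bass_module Phi B) :
  ~ pp_stabilizes Phi -> ~ mittag_leffler B /\ ~ pure_projective B.
Proof.
move=> unstable.
suff notML : ~ mittag_leffler B by split=> // /pure_projective_mittag_leffler.
move=> mlB; apply: unstable.
have [A [a [g [f [_ free ga lim]]]]] := hB.
have fa i j : f i (a i j) = f 0%N (a 0%N j).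
  by elim: i => // i IHi; rewrite -ga lim.1.
have [phi phib gen] := mlB n (f 0%N \o a 0%N).
have [k phik] := direct_limit_pp lim ga phib.
exists k => i ki M; apply/seteqP; split.
  elim: i ki => [|i IHi]; first by rewrite leqn0 => /eqP ->.
  rewrite leq_eqVlt ltnS => /predU1P[-> //|ki] x /hPhi; exact: IHi.
move=> x /(free_realization_generates (free k) phik).
apply: gen; rewrite /pp_type /= (_ : _ \o _ = f i \o a i).
  by apply: pp_set_linear; case: (free i).
by apply/funext => j /=; rewrite fa.
Qed.
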